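(* Assume (A3), (A4), let $p\in(0,2)$ and $q\in(0,1]$ with $q+1<p$, and let $x$ be a trajectory solution of (MTRIGS) with initial data $(x_0,v_0)$. Then for every $r\in[q,\frac{q+1}2]$, $$\int_{t_0}^{+\infty}s^{2r-q}\|\dot x(s)\|^2\,ds<+\infty .$$
   Context: $\mathcal H$ real Hilbert space; $f_1,\dots,f_m:\mathcal H\to\mathbb R$ convex, continuously differentiable with Lipschitz continuous gradients; $F=(f_1,\dots,f_m)^\top$. Weak Pareto optimal: no $x$ with $f_i(x)<f_i(x^* )$ for all $i$; $\mathcal P_w$ the set of such points. $\mathcal L(F,b):=\{x:f_i(x)\le b_i\ \forall i\}$, $\mathcal{LP}_w(F,b):=\mathcal L(F,b)\cap\mathcal P_w$. Parameters $t_0>0$, $\alpha,\beta>0$, $q\in(0,1]$, $p\in(0,2]$, initial data $x_0,v_0\in\mathcal H$; $C(x):=\operatorname{conv}\{\nabla f_i(x)\}$. A trajectory solution of (MTRIGS) is $x:[t_0,\infty)\to\mathcal H$, continuously differentiable, with $\dot x$ absolutely continuous on each $[t_0,T]$ and a.e. derivative $\ddot x$ (Bochner measurable, $\dot x(t)=\dot x(t_0)+\int_{t_0}^t\ddot x$), satisfying $\frac{\alpha}{t^q}\dot x(t)+\operatorname{proj}_{C(x(t))+\frac{\beta}{t^p}x(t)+\ddot x(t)}(0)=0$ for a.e. $t\ge t_0$, $x(t_0)=x_0$, $\dot x(t_0)=v_0$. (A3): with $a_i:=\frac{\beta}{2t_0^p}\|x_0\|^2+\frac12\|v_0\|^2$,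 for every $x\in\mathcal L(F,F(x_0)+a)$, $\mathcal{LP}_w(F,F(x))\ne\emptyset$, and $R:=\sup_{F^*\in F(\mathcal{LP}_w(F,F(x_0)+a))}\inf_{z\in F^{-1}(\{F^*\})}\|z\|<\infty$. (A4): $S(w):=\operatorname{argmin}_z\max_i(f_i(z)-w_i)\neq\emptyset$ for all $w\in\mathbb R^m$ and $w\mapsto\operatorname{proj}_{S(w)}(0)$ is continuous. *)

(* Defs.v *)
From HB Require Import structures.
From mathcomp Require Import all_boot all_order all_algebra.
From mathcomp Require Import all_classical all_reals all_analysis.
Set Implicit Arguments.
Unset Strict Implicit.
Unset Printing Implicit Defensive.
Import Order.TTheory GRing.Theory Num.Theory.
Import numFieldNormedType.Exports.
Local Open Scope classical_set_scope.
Local Open Scope ring_scope.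

(* A real Hilbert space is a complete normed space whose norm comes from an
   inner product [ip]. *)
Definition is_inner_product (R : realType) (H : normedModType R)
  (ip : H -> H -> R) : Prop :=
  [/\ forall x y, ip x y = ip y x,
      forall (a : R) x y z, ip (a *: x + y) z = a * ip x z + ip y z &
      forall x, ip x x = `|x| ^+ 2].

Definition convex_fun (R : realType) (H : normedModType R) (f : H -> R) : Prop :=
  forall (x y : H) (l : R), 0 <= l <= 1 ->
    f (l *: x + (1 - l) *: y) <= l * f x + (1 - l) * f y.

Definition is_gradient (R : realType) (H : normedModType R)
  (ip : H -> H -> R) (f : H -> R) (g : H -> H) : Prop :=
  forall x : H, differentiable f x /\ forall h : H, 'd f x h = ip (g x) h.

Definition lipschitz_fun (R : realType) (H : normedModType R) (g : H -> H) : Prop :=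
  exists L : R, forall x y : H, `|g x - g y| <= L * `|x - y|.

Definition conv_hull (R : realType) (H : normedModType R) (m : nat)
  (u : 'I_m -> H) : set H :=
  [set y | exists lam : 'I_m -> R,
     [/\ forall i, 0 <= lam i, \sum_(i < m) lam i = 1 &
         y = \sum_(i < m) lam i *: u i]].

Definition is_proj0 (R : realType) (H : normedModType R) (K : set H) (y : H) : Prop :=
  K y /\ forall z, K z -> `|y| <= `|z|.

Definition weak_pareto (R : realType) (H : normedModType R) (m : nat)
  (f : 'I_m -> H -> R) (xs : H) : Prop :=
  ~ exists x : H, forall i, f i x < f i xs.

Definition level_set (R : realType) (H : normedModType R) (m : nat)
  (f : 'I_m -> H -> R) (b : 'I_m -> R) : set H :=
  [set x | forall i, f i x <= b i].

Definition level_pareto (R : realType) (H : normedModType R) (m : nat)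
  (f : 'I_m -> H -> R) (b : 'I_m -> R) : set H :=
  level_set f b `&` [set x | weak_pareto f x].

Definition assumption_A3 (R : realType) (H : normedModType R) (m : nat)
  (f : 'I_m -> H -> R) (t0 beta p : R) (x0 v0 : H) : Prop :=
  let a : R := beta / (2 * t0 `^ p) * `|x0| ^+ 2 + 2^-1 * `|v0| ^+ 2 in
  let b : 'I_m -> R := fun i => f i x0 + a in
  (forall x, level_set f b x -> level_pareto f (fun i => f i x) !=set0) /\
  (exists Rb : R, forall y, level_pareto f b y ->
      inf [set `|z| | z in [set z | forall i, f i z = f i y]] <= Rb).

Definition max_shift (R : realType) (H : normedModType R) (m : nat)
  (f : 'I_m -> H -> R) (w : 'rV[R]_m) (z : H) : \bar R :=
  \big[Order.max/-oo%E]_(i < m) (f i z - w 0 i)%:E.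

Definition S_argmin (R : realType) (H : normedModType R) (m : nat)
  (f : 'I_m -> H -> R) (w : 'rV[R]_m) : set H :=
  [set z | forall y, (max_shift f w z <= max_shift f w y)%E].

Definition assumption_A4 (R : realType) (H : normedModType R) (m : nat)
  (f : 'I_m -> H -> R) : Prop :=
  (forall w, S_argmin f w !=set0) /\
  exists P : 'rV[R]_m -> H,
    (forall w, is_proj0 (S_argmin f w) (P w)) /\ continuous P.

Definition MTRIGS_solution (R : realType) (H : normedModType R)
  (ip : H -> H -> R) (m : nat) (g : 'I_m -> H -> H)
  (t0 alpha beta q p : R) (x0 v0 : H) (x xd xdd : R -> H) : Prop :=
      {within `[t0, +oo[, continuous x} /\
      {within `[t0, +oo[, continuous xd} /\
      (forall t, t0 < t -> is_derive t 1 x (xd t)) /\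
      {ae (@lebesgue_measure R), forall t, t0 < t -> is_derive t 1 xd (xdd t)} /\
      (* xd(t) = xd(t0) + \int_{t0}^t xdd  (Bochner integral, tested weakly) *)
      (forall T, t0 <= T ->
         (@lebesgue_measure R).-integrable `[t0, T] (fun s => (`|xdd s|)%:E) /\
         forall h : H,
           (@lebesgue_measure R).-integrable `[t0, T] (fun s => (ip (xdd s) h)%:E) /\
           (ip (xd T) h)%:E = (ip (xd t0) h)%:E +
              (\int[@lebesgue_measure R]_(s in `[t0, T]) (ip (xdd s) h)%:E)%E) /\
      {ae (@lebesgue_measure R), forall t, t0 <= t ->
         is_proj0
           [set c + (beta / t `^ p) *: x t + xdd t | c in conv_hull (fun i => g i (x t))]
           (- ((alpha / t `^ q) *: xd t))} /\
      x t0 = x0 /\ xd t0 = v0.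

(* Main.v *)
(** Since [2 * r - q <= 1] it suffices to bound [\int s |x'(s)|^2].  The
    projection inequality makes every energy
    [E_i = f_i(x) + beta / (2 t^p) |x|^2 + |x'|^2 / 2] decrease at rate at least
    [alpha t^-q |x'|^2].  Hence [x T] stays in the initial level set, and (A3)
    gives a point [z] of norm bounded independently of [T] with
    [f_i z <= f_i (x T)] for all [i].  For this [z], and [T] fixed, the function
    [min_i t^(1+q) (E_i - f_i z) + alpha / 2 \int_t0^t s |x'|^2
     + (1+q) (t^q <x', x-z> + alpha / 2 |x-z|^2 - q / 2 t^(q-1) |x-z|^2) + c t^(q-p+1)]
    is nonincreasing for large times: [q < 1] lets [alpha t |x'|^2] absorb
    [t^q |x'|^2], [p < 2] lets the Tikhonov term absorb [t^(q-2) |x-z|^2], and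
    [q + 1 < p] makes [t^(q-p)] integrable.  At time [T] it dominates
    [alpha / 2 \int_t0^T s |x'|^2], and its initial value is bounded uniformly in [z]. *)
Require Import Defs.
From HB Require Import structures.
From mathcomp Require Import all_boot all_order all_algebra.
From mathcomp Require Import all_classical all_reals all_analysis.
From mathcomp Require Import measurable_realfun ring lra.
Set Implicit Arguments.
Unset Strict Implicit.
Unset Printing Implicit Defensive.
Import Order.TTheory GRing.Theory Num.Theory.
Import numFieldNormedType.Exports.
Local Open Scope classical_set_scope.
Local Open Scope ring_scope.

(** * Monotonicity from an almost everywhere derivative bound *)

(** Supremum argument: the set of [t] with [psi t <= psi a] contains its supremum by the control
    from the left, and the step to the right would pass beyond the supremum unless it equals [b]. No
    continuity of [psi] is asked for, so upward moves to the left of a point remain controlled while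
    downward jumps are allowed. *)
Lemma right_nonincreasing_le (R : realType) (a b : R) (psi : R -> R) :
  a <= b ->
  (forall t, a <= t < b -> exists2 s, t < s <= b & psi s <= psi t) ->
  (forall t, a <= t <= b -> forall e, 0 < e ->
     exists2 d, 0 < d & forall s, a <= s <= t -> t - d < s -> psi t <= psi s + e) ->
  psi b <= psi a.
Proof.
move=> ab hr hl.
pose S := [set t | a <= t <= b /\ psi t <= psi a].
have Sa : S a by rewrite /S /= lexx ab.
have bS : ubound S b by move=> t [/andP[_ ->]].
have supS : has_sup S by split; [exists a|exists b].
have aS : a <= sup S by apply: ub_le_sup => //; exists b.
have Sb : sup S <= b by apply: ge_sup => //; exists a.
have SS : psi (sup S) <= psi a.
  apply/ler_addgt0Pr => e e0.
  have [|d d0 hd] := hl (sup S) _ e e0; first by rewrite aS Sb.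
  have [s Ss ds] := sup_adherent d0 supS.
  apply: le_trans (hd s _ ds) _; last by rewrite lerD2r; case: Ss.
  by case: (Ss) => /andP[-> _] _ /=; apply: ub_le_sup => //; exists b.
move: Sb; rewrite le_eqVlt => /predU1P[<- //|Sb].
have [|s /andP[ss sb] hs] := hr (sup S); first by rewrite aS Sb.
suff : s <= sup S by rewrite leNgt ss.
apply: ub_le_sup; first by exists b.
by split; [rewrite sb (le_trans aS (ltW ss))|exact: le_trans hs SS].
Qed.

(** * Primitives of integrable functions and exceptional null sets *)

Section primitive.
Context {R : realType}.
Notation mu := (@lebesgue_measure R).

(** Integrating from minus infinity avoids a base point; estimates only involve increments, given by
    [primitiveB]. *)
Definition primitive (k : R -> R) (t : R) : R :=
  \int[mu]_(s in [set` `]-oo, t]]) k s.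

Lemma ge0_subset_Rintegral (k : R -> R) (A B : set R) :
  measurable A -> measurable B -> mu.-integrable B (EFin \o k) ->
  (forall x, 0 <= k x) -> A `<=` B ->
  \int[mu]_(x in A) k x <= \int[mu]_(x in B) k x.
Proof.
move=> mA mB ik k0 AB; apply: fine_le.
- by apply: integrable_fin_num => //; exact: integrableS ik.
- exact: integrable_fin_num.
- apply: ge0_subset_integral => //.
  + exact: measurable_int ik.
  + by move=> x _; rewrite lee_fin.
Qed.

Lemma integrableZl_EFin (k : R -> R) (A : set R) (c : R) : measurable A ->
  mu.-integrable A (EFin \o k) -> mu.-integrable A (EFin \o (fun x => c * k x)).
Proof.
move=> mA ik; rewrite (_ : _ \o _ = (fun x => c%:E * (EFin \o k) x)%E).
  exact: integrableZl.
by apply/funext => x; rewrite /= EFinM.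
Qed.

Lemma primitiveB (k : R -> R) s t : mu.-integrable setT (EFin \o k) -> s <= t ->
  primitive k t - primitive k s = \int[mu]_(x in `]s, t]) k x.
Proof.
move=> ik st; rewrite /primitive Rintegral_itvB//.
by apply: integrableS ik => //.
Qed.

Lemma primitive_le (k : R -> R) s t : mu.-integrable setT (EFin \o k) ->
  (forall x, 0 <= k x) -> s <= t -> primitive k s <= primitive k t.
Proof.
move=> ik k0 st; rewrite -subr_ge0 primitiveB//.
by apply: Rintegral_ge0.
Qed.

(** Outer regularity gives open covers of arbitrarily small measure, and absolute continuity of the
    integral makes [k] small on them. *)
Lemma null_set_cover (k : R -> R) (N : set R) (e : R) :
  mu.-integrable setT (EFin \o k) -> (forall x, 0 <= k x) ->
  mu.-negligible N -> 0 < e ->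
  exists U : set R, [/\ open U, N `<=` U & \int[mu]_(x in U) k x < e].
Proof.
move=> ik k0 [M [mM M0 NM]] e0.
have [d [d0 hd]] := integral_normr_continuous ik e0.
have [|U [oU MU Ud]] := @lebesgue_regularity_outer R M d mM _ d0.
- by rewrite /= M0.
exists U; split => //; first exact: subset_trans MU.
under eq_Rintegral do rewrite -[k _]ger0_norm//.
apply: hd; first exact: open_measurable.
have mU : measurable U by exact: open_measurable.
rewrite -(setDUK MU) measureU//; [|exact: measurableD|exact: setDIK].
by rewrite /= M0 add0e.
Qed.

(* The null set where the derivative bound fails is absorbed by the small
   primitive of [k \_ U], with [U] a small open cover of that set. *)
Lemma ae_nonincreasing_le (a b : R) (k phi : R -> R) :
  a <= b -> mu.-integrable setT (EFin \o k) -> (forall x, 0 <= k x) ->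
  (forall s t, a <= s -> s <= t -> t <= b ->
     phi t - phi s <= primitive k t - primitive k s) ->
  {ae mu, forall t, a < t < b -> forall e, 0 < e ->
     \forall s \near t^'+, phi s - phi t <= e * (s - t)} ->
  phi b <= phi a.
Proof.
move=> ab ik k0 phik [N0 [mN0 N00 hN0]].
apply/ler_addgt0Pr => e e0.
(* The point [a] joins the exceptional set because the slope bound is assumed only for [a < t]. Half
   of [e] is spent on [U], the other half on the slope [e']. *)
have [||U [oU NU Ue]] := @null_set_cover k (N0 `|` [set a]) (e / 2) ik k0 _ _.
- apply: negligibleU.
  + by exists N0; split.
  + by exists [set a]; split => //=; rewrite lebesgue_measure_set1.
- by rewrite divr_gt0.
have mU : measurable U by exact: open_measurable.
pose kU := k \_ U.
have kU0 x : 0 <= kU x by rewrite /kU patchE; case: ifP.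
have ikU : mu.-integrable setT (EFin \o kU).
  rewrite -restrict_EFin; apply/integrable_restrict => //; rewrite setTI.
  exact: integrableS ik.
(* The summand 1 keeps the denominator positive when [a = b]. *)
pose e' := e / 2 / (b - a + 1).
have ba1 : 0 < b - a + 1 by lra.
have e'0 : 0 < e' by rewrite !divr_gt0.
pose psi t := phi t - primitive kU t - e' * t.
suff psi_le : psi b <= psi a.
  have kUb : primitive kU b - primitive kU a <= e / 2.
    rewrite primitiveB//; apply: le_trans (ltW Ue).
    by rewrite [leRHS]Rintegral_mkcond -/kU ge0_subset_Rintegral.
  have : e' * (b - a) <= e / 2.
    rewrite /e' mulrAC ler_pdivrMr// ler_pM2l ?divr_gt0//; lra.
  move: psi_le kUb; rewrite /psi; lra.
apply: right_nonincreasing_le => //.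
- move=> t /andP[at_ tb].
  (* Inside [U] the growth of [phi] is paid for by [primitive kU], outside by the slope [e']. *)
  have [tU|tU] := pselect (U t).
  + have /nbhs_ballP[d /= d0 dU] : nbhs t U by exact: open_nbhs_nbhs.
    pose s := Num.min b (t + d / 2).
    have ts : t < s by rewrite lt_min tb ltrDl divr_gt0.
    have sb : s <= b by rewrite ge_min lexx.
    exists s; first by rewrite ts.
    have sd : s <= t + d / 2 by rewrite ge_min lexx orbT.
    rewrite /psi.
    have : phi s - phi t <= primitive kU s - primitive kU t.
      apply: le_trans (phik _ _ at_ (ltW ts) sb) _.
      rewrite !primitiveB ?(ltW ts)//.
      rewrite (@eq_Rintegral _ _ _ mu _ kU)// => x; rewrite inE /= in_itv /= => /andP[tx xs].
      rewrite /kU patchE mem_set//; apply: dU.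
      rewrite /ball /= ltr0_norm ?subr_lt0//; lra.
    have : e' * t <= e' * s by rewrite ler_pM2l// ltW.
    lra.
  + have tN : forall e, 0 < e -> \forall s \near t^'+, phi s - phi t <= e * (s - t).
      apply: contrapT => hn; apply: tU; apply: NU.
      have [->|ta] := eqVneq t a; [by right|left].
      apply: hN0 => /= h; apply: hn; apply: h.
      by rewrite tb andbT lt_neqAle eq_sym ta.
    have [s [hs sb ts]] : exists s, [/\ phi s - phi t <= e' * (s - t), s <= b & t < s].
      apply: (@filter_ex _ (t^'+)); near=> s; split.
      * by near: s; exact: tN.
      * by near: s; exact: nbhs_right_le.
      * by near: s; exact: nbhs_right_gt.
    exists s; first by rewrite ts.
    have := primitive_le ikU kU0 (ltW ts).
    rewrite /psi; lra.
- move=> t /andP[at_ tb] eta eta0.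
  have [d [d0 hd]] := integral_normr_continuous ik eta0.
  exists d => // s /andP[as_ st] ds.
  have : phi t - phi s <= eta.
    apply: le_trans (phik _ _ as_ st tb) _.
    rewrite primitiveB//.
    under eq_Rintegral do rewrite -[k _]ger0_norm//.
    apply/ltW/hd => //; rewrite /= lebesgue_measure_itv /= lte_fin; case: ifP => //.
    by rewrite -EFinD lte_fin; lra.
  have := primitive_le ikU kU0 st.
  have : e' * s <= e' * t by rewrite ler_pM2l.
  rewrite /psi; lra.
Unshelve. all: by end_near. Qed.

End primitive.

(** * Inner product calculus *)

Section scalar_derivatives.
Context {R : realType}.
Implicit Types (phi psi : R -> R) (t : R).

(** The rules are restated for pointwise expressions, so that nesting them yields functions
    convertible to [energy] and [lyapunov]. *)
Lemma is_derive_addf phi psi t dphi dpsi :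
  is_derive t 1 phi dphi -> is_derive t 1 psi dpsi ->
  is_derive t 1 (fun s => phi s + psi s) (dphi + dpsi).
Proof. exact: is_deriveD. Qed.

Lemma is_derive_mulf phi psi t dphi dpsi :
  is_derive t 1 phi dphi -> is_derive t 1 psi dpsi ->
  is_derive t 1 (fun s => phi s * psi s) (phi t * dpsi + psi t * dphi).
Proof. exact: is_deriveM. Qed.

Lemma is_derive_mulcf c phi t dphi :
  is_derive t 1 phi dphi -> is_derive t 1 (fun s => c * phi s) (c * dphi).
Proof. exact: is_deriveZ. Qed.

End scalar_derivatives.

Section inner_product.
Context {R : realType} {H : normedModType R} (ip : H -> H -> R).
Hypothesis ipP : is_inner_product ip.

Lemma ipC x y : ip x y = ip y x. Proof. by case: ipP. Qed.

Lemma ipxx x : ip x x = `|x| ^+ 2. Proof. by case: ipP. Qed.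

Lemma ipDl x y z : ip (x + y) z = ip x z + ip y z.
Proof. by case: ipP => _ /(_ 1 x y z) + _; rewrite scale1r mul1r. Qed.

Lemma ip0l z : ip 0 z = 0.
Proof. by apply: (addrI (ip 0 z)); rewrite -ipDl !addr0. Qed.

Lemma ipZl a x z : ip (a *: x) z = a * ip x z.
Proof. by case: ipP => _ /(_ a x 0 z) + _; rewrite addr0 ip0l addr0. Qed.

Lemma ipNl x z : ip (- x) z = - ip x z.
Proof. by rewrite -scaleN1r ipZl mulN1r. Qed.

Lemma ipBl x y z : ip (x - y) z = ip x z - ip y z.
Proof. by rewrite ipDl ipNl. Qed.

Lemma ipDr x y z : ip x (y + z) = ip x y + ip x z.
Proof. by rewrite ipC ipDl !(ipC x). Qed.

Lemma ipZr a x z : ip x (a *: z) = a * ip x z.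
Proof. by rewrite ipC ipZl ipC. Qed.

Lemma ipNr x z : ip x (- z) = - ip x z.
Proof. by rewrite ipC ipNl ipC. Qed.

Lemma ipBr x y z : ip x (y - z) = ip x y - ip x z.
Proof. by rewrite ipDr ipNr. Qed.

Lemma ip_suml (I : finType) (u : I -> H) z :
  ip (\sum_i u i) z = \sum_i ip (u i) z.
Proof. by apply: (big_morph (ip^~ z)) => [x y|]; rewrite ?ipDl ?ip0l. Qed.

Lemma normD_sqr x y : `|x + y| ^+ 2 = `|x| ^+ 2 + 2 * ip x y + `|y| ^+ 2.
Proof. by rewrite -!ipxx ipDl !ipDr (ipC y x); ring. Qed.

Lemma normB_sqr x y : `|x - y| ^+ 2 = `|x| ^+ 2 - 2 * ip x y + `|y| ^+ 2.
Proof. by rewrite normD_sqr ipNr normrN; ring. Qed.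

Lemma ip_le_norm x y : `|ip x y| <= `|x| * `|y|.
Proof.
have [->|y0] := eqVneq y 0; first by rewrite ipC ip0l !normr0 mulr0.
have y2 : 0 < `|y| ^+ 2 by rewrite exprn_gt0// normr_gt0.
(* Cauchy-Schwarz without division: the vector is [|y|^2] times the component of [x] orthogonal to
   [y]. *)
have := sqr_ge0 `| (`|y| ^+ 2 *: x - ip x y *: y) |.
rewrite normB_sqr ipZl ipZr !normrZ !exprMn !(real_normK (num_real _)) => h.
rewrite -(ler_pXn2r (n := 2))// ?nnegrE ?mulr_ge0// (real_normK (num_real _)) exprMn.
rewrite -(ler_pM2l y2); nra.
Qed.

(** Polarization reduces continuity of [ip] to continuity of the norm. *)
Lemma ip_cvg (T : Type) (F : set_system T) {FF : Filter F} (a b : T -> H) (x y : H) :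
  a @ F --> x -> b @ F --> y -> (fun t => ip (a t) (b t)) @ F --> ip x y.
Proof.
have ipE u v : ip u v = (`|u + v| * `|u + v| - `|u - v| * `|u - v|) / 4.
  by rewrite -!expr2 normD_sqr normB_sqr; field.
move=> ax by_; rewrite ipE (_ : (fun t => _) = fun t =>
  (`|a t + b t| * `|a t + b t| - `|a t - b t| * `|a t - b t|) / 4); last first.
  by apply/funext => t; rewrite ipE.
have nD : (fun t => `|a t + b t|) @ F --> `|x + y| by apply: cvg_norm; exact: cvgD.
have nB : (fun t => `|a t - b t|) @ F --> `|x - y| by apply: cvg_norm; exact: cvgB.
by apply: cvgMr_tmp; apply: cvgB; exact: cvgM.
Qed.

Lemma is_derive_ip (a b : R -> H) (t : R) (da db : H) :
  is_derive t 1 a da -> is_derive t 1 b db ->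
  is_derive t 1 (fun s => ip (a s) (b s)) (ip da (b t) + ip (a t) db).
Proof.
move=> ha hb.
have ca : (fun h : R => a (h *: 1 + t)) @ 0^' --> a t.
  have ht : (fun h : R => h *: (1 : R) + t) @ (0 : R) --> (0 : R) *: (1 : R) + t.
    by apply: cvgD; [apply: cvgZr_tmp; exact: cvg_id|exact: cvg_cst].
  rewrite scale0r add0r in ht.
  apply: cvg_within_filter; apply: cvg_comp ht _.
  have : {for t, continuous a}.
    by apply: differentiable_continuous; apply/derivable1_diffP; case: ha.
  exact.
have qa : (fun h : R => h^-1 *: (a (h *: 1 + t) - a t)) @ 0^' --> da.
  by have [ea <-] := ha; exact: ea.
have qb : (fun h : R => h^-1 *: (b (h *: 1 + t) - b t)) @ 0^' --> db.
  by have [eb <-] := hb; exact: eb.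
have cb : (fun h : R => b t) @ 0^' --> b t by exact: cvg_cst.
(* The quotient splits into the quotient of [a] against [b t] plus the shifted [a] against the
   quotient of [b]; the second part uses continuity of [a] at [t]. *)
have key : (fun h : R => h^-1 *: (ip (a (h *: 1 + t)) (b (h *: 1 + t)) - ip (a t) (b t)))
     @ 0^' --> ip da (b t) + ip (a t) db.
  have ea := @ip_cvg _ _ _ _ _ _ _ qa cb; have eb := @ip_cvg _ _ _ _ _ _ _ ca qb.
  have eab := cvgD (ea _) (eb _).
  apply: cvg_trans; last exact: eab.
  apply: near_eq_cvg; near=> h => /=.
  by rewrite !fctE ipZl ipZr ipBl ipBr -mulrDr; congr (_ * _); ring.
split; first by apply/cvg_ex; exists (ip da (b t) + ip (a t) db).
exact: cvg_lim key.
Unshelve. all: by end_near. Qed.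

(** By convexity the difference quotients of [f] from [x] towards [z] are at most [f z - f x]; they
    tend to the directional derivative. *)
Lemma gradient_le (f : H -> R) (g : H -> H) : convex_fun f -> is_gradient ip f g ->
  forall x z, f x + ip (g x) (z - x) <= f z.
Proof.
move=> cf gf x z; have [df dfE] := gf x.
have qf : (fun h : R => h^-1 *: (f (h *: (z - x) + x) - f x)) @ 0^'+ --> ip (g x) (z - x).
  rewrite -dfE -deriveE//; apply: cvg_dnbhs_at_right.
  exact: (diff_derivable (v := z - x) df).
rewrite addrC -lerBrDr; apply: (cvgr_to_le qf).
near=> h; have h0 : 0 < h by [].
rewrite [leLHS]mulrC ler_pdivrMr// lerBlDr.
have -> : h *: (z - x) + x = h *: z + (1 - h) *: x.
  by rewrite scalerBr scalerBl scale1r -addrA [- _ + x]addrC.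
apply: le_trans (cf _ _ _ _) _; last by lra.
by rewrite ltW//=; near: h; exact: nbhs_right_le.
Unshelve. all: by end_near. Qed.

Lemma is_derive_gradient_comp (f : H -> R) (g : H -> H) (x : R -> H) (t : R) dx :
  is_gradient ip f g -> is_derive t 1 x dx ->
  is_derive t 1 (fun s => f (x s)) (ip (g (x t)) dx).
Proof.
move=> gf [xt <-]; have [df dfE] := gf (x t).
have dx' : differentiable x t by exact/derivable1_diffP.
split; first by apply: diff_derivable; exact: differentiable_comp.
rewrite deriveE; last exact: differentiable_comp.
by rewrite diff_comp//= dfE deriveE.
Qed.

End inner_product.

(** * Variation dominated by a primitive *)

Section dominated_variation.
Context {R : realType} (K : R -> R) (a b : R).
Hypothesis Kle : forall s t, a <= s -> s <= t -> t <= b -> t - s <= K t - K s.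

(* Quantified absolute continuity: [K] will be a primitive of [1 + |x''|]. *)
Definition dom_var (V : normedModType R) (phi : R -> V) : Prop :=
  exists M, forall s t, a <= s -> s <= t -> t <= b ->
    `|phi t - phi s| <= M * (K t - K s).

Lemma dom_var_ge0 (V : normedModType R) (phi : R -> V) : dom_var phi ->
  exists2 M, 0 <= M & forall s t, a <= s -> s <= t -> t <= b ->
    `|phi t - phi s| <= M * (K t - K s).
Proof.
move=> [M hM]; exists `|M| => // s t as_ st tb.
apply: le_trans (hM s t as_ st tb) _; apply: ler_wpM2r; last exact: ler_norm.
have := Kle as_ st tb; lra.
Qed.

Lemma dom_var_bounded (V : normedModType R) (phi : R -> V) : dom_var phi ->
  exists2 B, 0 <= B & forall t, a <= t <= b -> `|phi t| <= B.
Proof.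
move=> /dom_var_ge0[M M0 hM]; exists (`|phi a| + M * `|K b - K a|).
  by rewrite addr_ge0// mulr_ge0.
move=> t /andP[at_ tb].
rewrite -[phi t](subrK (phi a)) addrC; apply: le_trans (ler_normD _ _) _.
rewrite lerD2l; apply: le_trans (hM a t (lexx _) at_ tb) _; apply: ler_wpM2l => //.
apply: le_trans (ler_norm _); rewrite lerD2r -subr_ge0.
have := Kle at_ tb (lexx _); lra.
Qed.

Lemma dom_var_lipschitz (V : normedModType R) (phi : R -> V) (M : R) :
  (forall s t, a <= s -> s <= t -> t <= b -> `|phi t - phi s| <= M * (t - s)) ->
  dom_var phi.
Proof.
move=> hM; exists `|M| => s t as_ st tb.
apply: le_trans (hM s t as_ st tb) _.
have h := Kle as_ st tb.
apply: le_trans (ler_wpM2l _ h); last exact: normr_ge0.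
by apply: ler_wpM2r; [rewrite subr_ge0|exact: ler_norm].
Qed.

Lemma dom_var_cst (V : normedModType R) (v : V) : dom_var (fun=> v).
Proof. by exists 0 => s t _ _ _; rewrite subrr normr0 mul0r. Qed.

Lemma dom_varD (V : normedModType R) (phi psi : R -> V) :
  dom_var phi -> dom_var psi -> dom_var (fun t => phi t + psi t).
Proof.
move=> [M hM] [N hN]; exists (M + N) => s t as_ st tb.
rewrite opprD addrACA mulrDl; apply: le_trans (ler_normD _ _) _.
by apply: lerD; [exact: hM|exact: hN].
Qed.

(** One product estimate serves both real multiplication and [ip]: each factor is bounded on the
    interval and the increment telescopes. *)
Lemma dom_var_bilinear (U V W : normedModType R) (op : U -> V -> W)
    (phi : R -> U) (psi : R -> V) :
  (forall x y z, op (x - y) z = op x z - op y z) ->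
  (forall x y z, op x (y - z) = op x y - op x z) ->
  (forall x y, `|op x y| <= `|x| * `|y|) ->
  dom_var phi -> dom_var psi -> dom_var (fun t => op (phi t) (psi t)).
Proof.
move=> opl opr ople hphi hpsi.
have [A A0 hA] := dom_var_bounded hphi; have [B B0 hB] := dom_var_bounded hpsi.
move: hphi hpsi => /dom_var_ge0[M M0 hM] /dom_var_ge0[N N0 hN].
exists (M * B + A * N) => s t as_ st tb.
have -> : op (phi t) (psi t) - op (phi s) (psi s) =
    op (phi t - phi s) (psi t) + op (phi s) (psi t - psi s).
  by rewrite opl opr addrA subrK.
rewrite mulrDl; apply: le_trans (ler_normD _ _) _; apply: lerD.
- apply: le_trans (ople _ _) _; rewrite mulrAC; apply: ler_pM => //; first exact: hM.
  by apply: hB; rewrite (le_trans as_ st).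
- apply: le_trans (ople _ _) _; rewrite -mulrA; apply: ler_pM => //; last exact: hN.
  by apply: hA; rewrite as_ (le_trans st tb).
Qed.

Lemma dom_varM (phi psi : R -> R) :
  dom_var phi -> dom_var psi -> dom_var (fun t => phi t * psi t).
Proof.
apply: (dom_var_bilinear (op := fun x y : R => x * y)) => [x y z|x y z|x y].
- by rewrite mulrBl.
- by rewrite mulrBr.
- by rewrite normrM.
Qed.

Lemma dom_var_powR (e : R) : 0 < a -> dom_var (fun t => t `^ e).
Proof.
(* The derivative of the power is monotone up to sign, so one of its end values bounds it; their sum
   does so for either sign of [e - 1]. *)
move=> a0; apply: (@dom_var_lipschitz _ _ (`|e| * (a `^ (e - 1) + b `^ (e - 1)))).
move=> s t as_ st tb.
have [||c] := @MVT_segment R (fun t => t `^ e) (fun c => e * c `^ (e - 1)) s t st.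
- move=> x; rewrite in_itv /= => /andP[sx _].
  by apply: is_derive1_powR; rewrite (lt_le_trans a0)// (le_trans as_)// ltW.
- apply: derivable_within_continuous => x; rewrite in_itv /= => /andP[sx _].
  by apply: derivable_powR; rewrite in_itv /= andbT (lt_le_trans a0)// (le_trans as_).
rewrite in_itv /= => /andP[sc ct] ->.
have c0 : 0 < c by rewrite (lt_le_trans a0)// (le_trans as_).
rewrite normrM [`|t - s|]ger0_norm ?subr_ge0//.
apply: ler_wpM2r; first by rewrite subr_ge0.
rewrite normrM; apply: ler_wpM2l => //; rewrite ger0_norm ?powR_ge0//.
have [e1|e1] := leP 0 (e - 1).
- apply: le_trans (_ : b `^ (e - 1) <= _); last by rewrite lerDr powR_ge0.
  by apply: ge0_ler_powR; rewrite ?nnegrE; lra.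
- apply: le_trans (_ : a `^ (e - 1) <= _); last by rewrite lerDl powR_ge0.
  rewrite -(opprK (e - 1)) !(powRN _ (- (e - 1))) lef_pV2 ?posrE ?powR_gt0//.
  by apply: ge0_ler_powR; rewrite ?nnegrE; lra.
Qed.

End dominated_variation.

Lemma dom_varS (R : realType) (K : R -> R) (a a' b : R) (V : normedModType R)
    (phi : R -> V) : a <= a' -> dom_var K a b phi -> dom_var K a' b phi.
Proof. by move=> aa' [M hM]; exists M => s t /(le_trans aa'); exact: hM. Qed.

Lemma is_derive_right_le (R : realType) (phi : R -> R) (t d e : R) :
  is_derive t 1 phi d -> d < e -> \forall s \near t^'+, phi s - phi t <= e * (s - t).
Proof.
move=> [ex <-] de.
have := cvg_dnbhs_at_right ex.
rewrite -/(derive _ _ _) => /cvgr_le/(_ _ de) h.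
rewrite nbhs_right0P; near=> h'.
have h'0 : 0 < h' by [].
rewrite addrAC subrr add0r mulrC -ler_pdivrMl//.
have -> : t + h' = h' *: 1 + t by rewrite addrC /GRing.scale /= mulr1.
by near: h'.
Unshelve. all: by end_near. Qed.

(* Derivatives are only needed for the indices active at [t]: to the right of [t]
   the minimum stays below such a [Phi i], and they agree at [t]. *)
Lemma min_nonincreasing_le (R : realType) (m : nat) (i0 : 'I_m)
    (Phi : 'I_m -> R -> R) (a b : R) (k : R -> R) :
  a <= b -> (@lebesgue_measure R).-integrable setT (EFin \o k) ->
  (forall x, 0 <= k x) ->
  (forall i, dom_var (primitive k) a b (Phi i)) ->
  {ae (@lebesgue_measure R), forall t, a < t < b ->
     forall i, (forall j, Phi i t <= Phi j t) ->
     exists2 d, d <= 0 & is_derive t 1 (Phi i) d} ->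
  exists i, forall j, Phi i b <= Phi j a.
Proof.
move=> ab ik k0 /choice[M hM] hae.
pose im t := [arg min_(i < i0) Phi i t]%O.
have imP t j : Phi (im t) t <= Phi j t.
  by rewrite /im; case: Order.TotalTheory.arg_minP => // i _ /(_ j isT).
(* The active index varies with time, so one constant has to serve all indices. *)
pose N := \sum_i `|M i|.
have N0 : 0 <= N by apply: sumr_ge0.
have ikN : (@lebesgue_measure R).-integrable setT (EFin \o (fun x => N * k x)).
  exact: integrableZl_EFin.
exists (im b) => j; apply: le_trans (imP a j).
apply: (@ae_nonincreasing_le R a b (fun x => N * k x) (fun t => Phi (im t) t)) => //.
- by move=> x; rewrite mulr_ge0.
- move=> s t as_ st tb.
  rewrite primitiveB//.
  rewrite RintegralZl//; last exact: integrableS ik.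
  rewrite -primitiveB//.
  (* Keeping the index active at [s] bounds the minimum at [t] from above, so the increment is that
     of a single [Phi i]. *)
  have : Phi (im t) t <= Phi (im s) t by [].
  rewrite -(lerD2r (- Phi (im s) s)) => /le_trans; apply.
  apply: le_trans (ler_norm _) _; apply: le_trans (hM (im s) s t as_ st tb) _.
  apply: ler_wpM2r; first by rewrite subr_ge0 primitive_le.
  apply: le_trans (ler_norm _) _.
  by rewrite /N (bigD1 (im s))//= lerDl sumr_ge0.
- apply: negligibleS hae => t; apply: contra_not => /= ht tab e e0.
  have [d d0 hd] := ht tab (im t) (imP t).
  have := is_derive_right_le hd (le_lt_trans d0 e0).
  apply: filterS => s; apply: le_trans; rewrite lerD2r; exact: imP.
Qed.

(** * The Lyapunov function along a trajectory *)

(** Variational inequality of the projection, tested at the vertex [u i + w]: moving from [y]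
    towards it stays in the shifted hull and cannot decrease the norm. *)
Lemma proj0_conv_hull_le (R : realType) (H : normedModType R) (ip : H -> H -> R)
    (m : nat) (u : 'I_m -> H) (w y : H) :
  is_inner_product ip -> is_proj0 [set c + w | c in conv_hull u] y ->
  forall i, `|y| ^+ 2 <= ip (u i + w) y.
Proof.
move=> ipP [[c [lam [lam0 lam1 cE]] cy] hmin] i.
have key l : 0 <= l <= 1 -> 0 <= 2 * l * ip y (u i + w - y) + l ^+ 2 * `|u i + w - y| ^+ 2.
  move=> /andP[l0 l1].
  have : `|y| ^+ 2 <= `|y + l *: (u i + w - y)| ^+ 2.
    rewrite lerXn2r ?nnegrE//; apply: hmin.
    exists ((1 - l) *: c + l *: u i); last first.
      have -> : u i + w - y = u i - c by rewrite -cy opprD addrACA subrr addr0.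
      rewrite -cy scalerBl scale1r scalerBr -!addrA; congr (_ + _).
      by rewrite [LHS]addrC [RHS]addrA; congr (_ + _); rewrite addrC.
    have s1 : \sum_j (j == i)%:R = 1 :> R.
      by rewrite (bigD1 i)//= eqxx big1 ?addr0// => j /negbTE ->.
    exists (fun j => (1 - l) * lam j + l * (j == i)%:R); split.
    - by move=> j; rewrite addr_ge0// mulr_ge0// subr_ge0.
    - by rewrite big_split /= -!mulr_sumr lam1 s1; ring.
    - rewrite cE scaler_sumr; under [RHS]eq_bigr do rewrite scalerDl -!scalerA.
      rewrite big_split /=; congr (_ + _).
      rewrite (bigD1 i)//= eqxx scale1r big1 ?addr0// => j /negbTE ->.
      by rewrite scale0r scaler0.
  by rewrite (normD_sqr ipP) (ipZr ipP) normrZ exprMn (real_normK (num_real _)); lra.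
have -> : ip (u i + w) y = `|y| ^+ 2 + ip y (u i + w - y).
  by rewrite -(ipxx ipP) -(ipDr ipP) [y + _]addrC subrK (ipC ipP).
rewrite lerDl leNgt; apply/negP => neg.
set c0 := ip y _ in key neg; set n := `|_| ^+ 2 in key.
have n0 : 0 <= n by apply: sqr_ge0.
(* The minimizer [- c0 / n] of the quadratic, with a denominator enlarged so that it is positive
   even for [n = 0] and [l <= 1]; the quadratic is still negative there. *)
pose l := - c0 / (n - c0 + 1).
have D0 : 0 < n - c0 + 1 by lra.
have l0 : 0 < l by rewrite divr_gt0// oppr_gt0.
have l1 : l <= 1 by rewrite ler_pdivrMr//; lra.
have := key l; rewrite (ltW l0) l1 => /(_ isT).
have lD : l * (n - c0 + 1) = - c0 by rewrite /l divfK// gt_eqF.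
rewrite leNgt => /negP; apply.
have : l * (2 * c0 + l * n) < 0 by rewrite pmulr_rlt0//; nra.
lra.
Qed.

(* Here [X = t^q], [P = t^-p], [d] is the rate of [E_i], [h = f_i x - f_i z], and
   [uu], [ud], [Ad], [dd], [xx], [zz] are the inner products of [u = x'],
   [A = x''], [d = x - z], [x] and [z]. *)
Lemma lyapunov_rate_le (R : realFieldType)
    (t X P d h uu ud Ad dd xx zz q alpha beta : R) :
  0 < t -> 0 < X -> 0 < P -> 0 < q -> 0 <= uu -> 0 <= dd ->
  X * d <= - alpha * uu ->
  X * Ad + alpha * ud + X * h + beta / 2 * (X * P) * (xx + dd - zz) <= 0 ->
  3 * (1 + q) * X <= alpha * t ->
  q * (1 - q) <= beta * P * t ^+ 2 ->
  t * (X * d) + (1 + q) * X * (h + beta / 2 * P * xx + uu / 2) + alpha / 2 * t * uu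
  + (1 + q) * (X * (Ad + uu) + alpha * ud + q * (1 - q) / 2 * (X / t ^+ 2) * dd)
  - (1 + q) * beta / 2 * zz * (X * P) <= 0.
Proof.
move=> t0 X0 P0 q0 uu0 dd0 hd hA h1 h2.
(* After [a1] and [a2] there remain the [uu] terms, with total coefficient
   [3 / 2 * (1 + q) * X - alpha / 2 * t], signed by [a3], and the [dd] terms, signed by [a4]. *)
have a1 : t * (X * d) <= t * (- alpha * uu) by rewrite ler_pM2l.
have a2 : (1 + q) * (X * Ad + alpha * ud + X * h + beta / 2 * (X * P) * (xx + dd - zz)) <= 0.
  by rewrite pmulr_rle0//; lra.
have a3 : 3 * (1 + q) * X * uu <= alpha * t * uu by exact: ler_wpM2r.
have a4 : (1 + q) / 2 * (q * (1 - q) * (X / t ^+ 2) * dd) <=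
          (1 + q) / 2 * (beta * P * X * dd).
  apply: ler_wpM2l; first lra.
  apply: ler_wpM2r => //; rewrite mulrA ler_pdivrMr ?exprn_gt0// [leRHS]mulrAC ler_pM2r//.
by lra.
Qed.

(** * Absolute continuity along the trajectory *)

Section trajectory.
Context {R : realType} {H : completeNormedModType R} (ip : H -> H -> R).
Context (m : nat) (f : 'I_m -> H -> R) (g : 'I_m -> H -> H).
Context (t0 alpha beta q p : R) (x0 v0 : H) (x xd xdd : R -> H).
Hypothesis ipP : is_inner_product ip.
Hypothesis f_convex : forall i, convex_fun (f i).
Hypothesis f_grad : forall i, is_gradient ip (f i) (g i).
Hypothesis g_lip : forall i, lipschitz_fun (g i).
Hypotheses (t0_gt0 : 0 < t0) (alpha_gt0 : 0 < alpha) (beta_gt0 : 0 < beta).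
Hypothesis sol : MTRIGS_solution ip g t0 alpha beta q p x0 v0 x xd xdd.
Notation mu := (@lebesgue_measure R).

Let x_cont : {within `[t0, +oo[, continuous x}. Proof. by case: sol. Qed.

Let xd_cont : {within `[t0, +oo[, continuous xd}. Proof. by case: sol => _ []. Qed.

Let x_deriv t : t0 < t -> is_derive t 1 x (xd t).
Proof. by case: sol => _ [_ [h _]]; exact: h. Qed.

Lemma integrable_acceleration T : t0 <= T ->
  mu.-integrable `[t0, T] (EFin \o (fun s => `|xdd s|)).
Proof. by case: sol => _ [_ [_ [_ [h _]]]] /h[]. Qed.

(** The weak integral identity becomes a norm bound when tested with the increment [h] itself. *)
Lemma velocity_increment (s t : R) : t0 <= s -> s <= t ->
  `|xd t - xd s| <= \int[mu]_(r in `]s, t]) `|xdd r|.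
Proof.
move=> t0s st; have t0t := le_trans t0s st.
have [_ [_ [_ [_ [w _]]]]] := sol.
set h := xd t - xd s.
have xdE r : t0 <= r -> mu.-integrable `[t0, r] (EFin \o (fun s => ip (xdd s) h)) /\
    ip (xd r) h = ip (xd t0) h + \int[mu]_(s in `[t0, r]) ip (xdd s) h.
  move=> /w[_ /(_ h)[ir e]]; split=> //.
  by have /(congr1 fine) := e; rewrite fineD//; exact: integrable_fin_num.
have [it et] := xdE t t0t; have [is_ es] := xdE s t0s.
have sub : [set` `]s, t]] `<=` [set` `[t0, t]].
  by move=> r /=; rewrite !in_itv /= => /andP[sr ->]; rewrite (le_trans t0s (ltW sr)).
have ia : mu.-integrable `]s, t] (EFin \o (fun r => `|xdd r|)).
  exact: integrableS (integrable_acceleration t0t).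
have ih : mu.-integrable `]s, t] (EFin \o (fun r => ip (xdd r) h)).
  exact: integrableS it.
have hh : `|h| ^+ 2 <= `|h| * \int[mu]_(r in `]s, t]) `|xdd r|.
  rewrite -(ipxx ipP) {1}/h (ipBl ipP) et es opprD addrACA subrr add0r Rintegral_itvB//.
  apply: le_trans (ler_norm _) _; apply: le_trans (le_normr_Rintegral _ ih) _ => //.
  rewrite -RintegralZl//; apply: le_Rintegral => //.
  - exact: (integrable_abse ih).
  - exact: integrableZl_EFin.
  - by move=> r _; rewrite mulrC; exact: ip_le_norm.
have [->|h0] := eqVneq h 0; first by rewrite normr0 Rintegral_ge0.
by rewrite -(ler_pM2l (x := `|h|)) ?normr_gt0// -expr2.
Qed.

(** The summand 1 makes the primitive dominate time increments, the norm of [xdd] makes it dominate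
    velocity increments, and the cutoff makes it integrable on the whole line. *)
Definition dominating_rate (T : R) : R -> R := (fun s => 1 + `|xdd s|) \_ `[t0, T].

Lemma dominating_rate_ge0 T s : 0 <= dominating_rate T s.
Proof. by rewrite /dominating_rate patchE; case: ifP => // _; rewrite addr_ge0. Qed.

Let integrable_cst1 (s t : R) : mu.-integrable `[s, t] (EFin \o (fun=> 1 : R)).
Proof.
apply: continuous_compact_integrable; first exact: segment_compact.
by apply: continuous_subspaceT => y; exact: cst_continuous.
Qed.

Lemma integrable_dominating_rate T : t0 <= T ->
  mu.-integrable setT (EFin \o dominating_rate T).
Proof.
move=> t0T; rewrite -restrict_EFin; apply/integrable_restrict => //; rewrite setTI.
rewrite (_ : _ \o _ = (EFin \o (fun=> 1%R : R)) \+ (EFin \o (fun s => `|xdd s|%R)))%E; last first.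
  by apply/funext => s.
by apply: integrableD => //; exact: integrable_acceleration.
Qed.

Lemma primitive_dominating_rateB T s t : t0 <= s -> s <= t -> t <= T ->
  primitive (dominating_rate T) t - primitive (dominating_rate T) s =
  (t - s) + \int[mu]_(r in `]s, t]) `|xdd r|.
Proof.
move=> t0s st tT; have t0T := le_trans t0s (le_trans st tT).
rewrite primitiveB//; last exact: integrable_dominating_rate.
have sub : [set` `]s, t]] `<=` [set` `[t0, T]].
  move=> r /=; rewrite !in_itv /= => /andP[sr rt].
  by rewrite (le_trans t0s (ltW sr)) (le_trans rt tT).
rewrite (@eq_Rintegral _ _ _ mu _ (fun r => 1 + `|xdd r|)); last first.
  move=> r /set_mem rst; rewrite /dominating_rate patchE mem_set//.
  exact: sub.
rewrite RintegralD//; last 2 first.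
- by apply: integrableS (integrable_cst1 s t) => //; exact: subset_itv_oc_cc.
- exact: integrableS (integrable_acceleration t0T).
congr (_ + _); rewrite Rintegral_cst//= lebesgue_measure_itv /= lte_fin mul1r.
by case: ltgtP st => //= -> _; rewrite subrr.
Qed.

Lemma dominating_rate_le T s t : t0 <= s -> s <= t -> t <= T ->
  t - s <= primitive (dominating_rate T) t - primitive (dominating_rate T) s.
Proof.
by move=> t0s st tT; rewrite primitive_dominating_rateB// lerDl Rintegral_ge0.
Qed.

Notation dv T := (dom_var (primitive (dominating_rate T)) t0 T).

Lemma dom_var_velocity T : dv T xd.
Proof.
exists 1 => s t t0s st tT; rewrite mul1r primitive_dominating_rateB//.
by apply: le_trans (velocity_increment t0s st) _; rewrite lerDr subr_ge0.
Qed.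

Lemma dom_var_position T : dv T x.
Proof.
have [B B0 hB] := dom_var_bounded (@dominating_rate_le T) (dom_var_velocity T).
apply: (dom_var_lipschitz (@dominating_rate_le T) (M := B)) => s t t0s st tT.
set h := x t - x s.
(* The mean value theorem is scalar, so it is applied to the component of [x] along the increment
   [h]. *)
have [||c] := @MVT_segment R (fun r => ip (x r) h) (fun r => ip (xd r) h + ip (x r) 0) s t st.
- move=> r; rewrite in_itv /= => /andP[sr _].
  by apply: is_derive_ip => //; apply: x_deriv; exact: le_lt_trans sr.
- have xc : {within `[s, t], continuous x}.
    apply: continuous_subspaceW x_cont => r /=; rewrite !in_itv /= andbT => /andP[sr _].
    exact: le_trans sr.
  by move=> r; apply: ip_cvg => //; [exact: xc|exact: cvg_cst].
rewrite in_itv /= => /andP[sc ct]; rewrite -(ipBl ipP) -/h (ipxx ipP).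
rewrite (ipC ipP (x c)) (ip0l ipP) addr0 => hh.
have hle : `|h| ^+ 2 <= `|h| * (B * (t - s)).
  rewrite hh; apply: le_trans (_ : `|xd c| * `|h| * (t - s) <= _).
    apply: ler_wpM2r; first by rewrite subr_ge0.
    by apply: le_trans (ler_norm _) _; exact: ip_le_norm.
  rewrite [`|xd c| * _]mulrC -mulrA; apply: ler_wpM2l => //.
  apply: ler_wpM2r; first by rewrite subr_ge0.
  by apply: hB; rewrite (le_trans t0s sc) (le_trans ct tT).
have [->|h0] := eqVneq h 0; first by rewrite normr0 mulr_ge0// subr_ge0.
by rewrite -(ler_pM2l (x := `|h|)) ?normr_gt0// -expr2.
Qed.

(** The gradient inequalities at [x s] and [x t] enclose the increment of [f i], and the Lipschitz
    gradient stays bounded along the trajectory on [[t0, T]]. *)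
Lemma dom_var_objective T i : dv T (fun t => f i (x t)).
Proof.
have [M M0 hM] := dom_var_ge0 (@dominating_rate_le T) (dom_var_position T).
have [L hL] := g_lip i.
have gx : dv T (fun t => g i (x t)).
  exists (`|L| * M) => s t t0s st tT; apply: le_trans (hL _ _) _.
  rewrite -mulrA; apply: le_trans (_ : `|L| * `|x t - x s| <= _).
    by apply: ler_wpM2r => //; exact: ler_norm.
  by apply: ler_wpM2l => //; exact: hM.
have [G G0 hG] := dom_var_bounded (@dominating_rate_le T) gx.
exists (G * M) => s t t0s st tT.
rewrite -mulrA; apply: le_trans (_ : G * `|x t - x s| <= _); last first.
  by apply: ler_wpM2l => //; exact: hM.
have gb r y : t0 <= r <= T -> `|ip (g i (x r)) y| <= G * `|y|.
  by move=> /hG h; apply: le_trans (ip_le_norm ipP _ _) _; exact: ler_wpM2r.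
have h1 := gradient_le (f_convex i) (f_grad i) (x t) (x s).
have h2 := gradient_le (f_convex i) (f_grad i) (x s) (x t).
have [|n1 n1'] := ler_normlP _ _ (gb t (x s - x t) _); first by rewrite (le_trans t0s st).
have [|n2 n2'] := ler_normlP _ _ (gb s (x t - x s) _); first by rewrite t0s (le_trans st tT).
rewrite distrC in n1 n1'.
apply/ler_normlP; split; lra.
Qed.

(** * Consequences of the projection equation *)

(** The energy inequality is the projection inequality at the vertex [i], divided by
    [alpha * t ^ (- q)]. The last inequality writes the projection as a convex combination and tests
    it with [x t - z]; convexity bounds each term by the common lower bound [h]. *)
Lemma ae_trajectory : {ae mu, forall t, t0 < t ->
  [/\ is_derive t 1 xd (xdd t),
      forall i, ip (g i (x t)) (xd t) + beta * t `^ (- p) * ip (x t) (xd t)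
        + ip (xdd t) (xd t) <= - (alpha * t `^ (- q)) * `|xd t| ^+ 2 &
      forall z h, (forall j, h <= f j (x t) - f j z) ->
        ip (xdd t) (x t - z) + alpha * t `^ (- q) * ip (xd t) (x t - z) + h
        + beta / 2 * t `^ (- p) * (`|x t| ^+ 2 + `|x t - z| ^+ 2 - `|z| ^+ 2) <= 0]}.
Proof.
have [_ [_ [_ [n1 [_ [n2 _]]]]]] := sol.
apply: negligibleS (negligibleU n1 n2) => t /= ht.
apply: contrapT => /not_orP[/contrapT h1 /contrapT h2]; apply: ht => t0t.
have {h2}hp := h2 (ltW t0t); split; first exact: h1.
- move=> i; set w := (beta / t `^ p) *: x t + xdd t.
  have {}hp : is_proj0 [set c + w | c in conv_hull (fun i => g i (x t))]
      (- ((alpha / t `^ q) *: xd t)).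
    rewrite (_ : [set c + w | c in _] =
       [set c + (beta / t `^ p) *: x t + xdd t | c in conv_hull (fun i => g i (x t))]) //.
    by apply/seteqP; split => _ [c hc <-]; exists c; rewrite ?addrA.
  have := proj0_conv_hull_le ipP hp i.
  rewrite normrN normrZ exprMn (real_normK (num_real _)) (ipNr ipP) (ipZr ipP).
  rewrite /w !(ipDl ipP) (ipZl ipP) -!powRN.
  have a0 : 0 < alpha * t `^ (- q) by rewrite mulr_gt0// powR_gt0// (lt_trans t0_gt0).
  by move: a0; set c := alpha * _ => a0 h; rewrite -(ler_pM2l a0); lra.
- move=> z h hz; have [[c [lam [lam0 lam1 cE]] cy] _] := hp.
  have := congr1 (fun v => ip v (x t - z)) cy.
  rewrite /= (ipNl ipP) !(ipDl ipP) !(ipZl ipP) -!powRN cE (ip_suml ipP).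
  have hs : h <= \sum_(i < m) ip (lam i *: g i (x t)) (x t - z).
    rewrite -[leLHS]mul1r -lam1 mulr_suml; apply: ler_sum => j _.
    rewrite (ipZl ipP); apply: ler_wpM2l => //; apply: le_trans (hz j) _.
    have := gradient_le (f_convex j) (f_grad j) (x t) z.
    rewrite -opprB (ipNr ipP); lra.
  (* Polarization turns the Tikhonov term [ip (x t) (x t - z)] into the three squares. *)
  have : `|z| ^+ 2 = `|x t| ^+ 2 - 2 * ip (x t) (x t - z) + `|x t - z| ^+ 2.
    by rewrite -(normB_sqr ipP) subKr.
  move=> ->; lra.
Qed.

(** * Decay of the energies *)

(** Squared norms are written with [ip] so that [is_derive_ip] differentiates them. *)
Definition energy (i : 'I_m) (t : R) : R :=
  f i (x t) + beta / 2 * (t `^ (- p) * ip (x t) (x t)) + 2^-1 * ip (xd t) (xd t).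

Definition kinetic (t : R) : R := \int[mu]_(s in `[t0, t]) (s * `|xd s| ^+ 2).

Lemma dom_var_ip T (u v : R -> H) : dv T u -> dv T v -> dv T (fun t => ip (u t) (v t)).
Proof.
apply: dom_var_bilinear; first exact: dominating_rate_le.
- exact: ipBl.
- exact: ipBr.
- exact: ip_le_norm.
Qed.

Lemma dom_var_scale T c (phi : R -> R) : dv T phi -> dv T (fun t => c * phi t).
Proof.
move=> h; apply: dom_varM => //; [exact: dominating_rate_le|exact: dom_var_cst].
Qed.

Lemma dom_var_energy T i : dv T (energy i).
Proof.
apply: dom_varD; last by apply: dom_var_scale; apply: dom_var_ip; exact: dom_var_velocity.
apply: dom_varD; first exact: dom_var_objective.
apply: dom_var_scale; apply: dom_varM; first exact: dominating_rate_le.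
  by apply: dom_var_powR => //; exact: dominating_rate_le.
by apply: dom_var_ip; exact: dom_var_position.
Qed.

Hypothesis p_gt0 : 0 < p.

Lemma energy_derive i t : t0 < t -> is_derive t 1 xd (xdd t) ->
  ip (g i (x t)) (xd t) + beta * t `^ (- p) * ip (x t) (xd t)
    + ip (xdd t) (xd t) <= - (alpha * t `^ (- q)) * `|xd t| ^+ 2 ->
  exists2 d, d <= - (alpha * t `^ (- q)) * `|xd t| ^+ 2 & is_derive t 1 (energy i) d.
Proof.
move=> t0t hA hb; have t_gt0 := lt_trans t0_gt0 t0t; have hx := x_deriv t0t.
have := is_derive_addf (is_derive_addf (is_derive_gradient_comp (f_grad i) hx)
  (is_derive_mulcf (beta / 2) (is_derive_mulf (is_derive1_powR (- p) t_gt0)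
     (is_derive_ip ipP hx hx)))) (is_derive_mulcf 2^-1 (is_derive_ip ipP hA hA)).
set d := (X in is_derive _ _ _ X) => hd; exists d => //.
apply: le_trans hb; rewrite /d (ipC ipP (xd t) (x t)) (ipC ipP (xd t) (xdd t)) (ipxx ipP).
(* Differentiating the decreasing weight [t ^ (- p)] contributes a nonpositive term, which is
   dropped. *)
have : 0 <= beta / 2 * (`|x t| ^+ 2 * (p * t `^ (- p - 1))).
  by rewrite !mulr_ge0 ?invr_ge0 ?powR_ge0 ?sqr_ge0// ltW.
lra.
Qed.

Lemma energy_le T i : t0 <= T -> energy i T <= energy i t0.
Proof.
move=> t0T.
(* A family with one member turns the minimum principle into plain monotonicity. *)
have [||j /(_ j)//] := @min_nonincreasing_le R 1 ord0 (fun=> energy i) t0 T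
  (dominating_rate T) t0T (integrable_dominating_rate t0T) (dominating_rate_ge0 T).
- by move=> _; exact: dom_var_energy.
- apply: negligibleS ae_trajectory => t; apply: contra_not => /= ht /andP[t0t _] _ _.
  have [hA hb _] := ht t0t; have [d hd hd'] := energy_derive t0t hA (hb i).
  exists d => //; apply: le_trans hd _; rewrite mulNr oppr_le0.
  by rewrite !mulr_ge0 ?powR_ge0 ?sqr_ge0// ltW.
Qed.

(** * The kinetic integral and the Lyapunov function *)

Let speed_cont : {within `[t0, +oo[, continuous (fun s => s * `|xd s| ^+ 2)}.
Proof.
have idc : {within `[t0, +oo[, continuous (fun s : R => s)}.
  by apply: continuous_subspaceT => y; exact: cvg_id.
move=> s; apply: cvgM; first exact: idc.
by apply: cvgM; apply: cvg_norm; exact: xd_cont.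
Qed.

Let speed_int t : mu.-integrable `[t0, t] (EFin \o (fun s => s * `|xd s| ^+ 2)).
Proof.
apply: continuous_compact_integrable; first exact: segment_compact.
apply: continuous_subspaceW speed_cont => r /=; rewrite !in_itv /= andbT.
by case/andP.
Qed.

Lemma kinetic_derive t : t0 < t -> is_derive t 1 kinetic (t * `|xd t| ^+ 2).
Proof.
move=> t0t.
(* The right end [t + 1] makes [t] an interior point. *)
have [||d1 d2] := @continuous_FTC1_closed R (fun s => s * `|xd s| ^+ 2) t0 t (t + 1) _
  (speed_int (t + 1)) t0t.
- by rewrite ltrDl.
- have : {within `]t0, +oo[, continuous (fun s => s * `|xd s| ^+ 2)}.
    apply: continuous_subspaceW speed_cont => r /=; rewrite !in_itv /= !andbT.
    exact: ltW.
  rewrite continuous_open_subspace//; apply.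
  by rewrite inE /= in_itv /= t0t.
- by split; [exact: d1|rewrite -derive1E].
Qed.

Lemma dom_var_kinetic T : dv T kinetic.
Proof.
have hx : dv T (fun s => s * ip (xd s) (xd s)).
  apply: dom_varM; first exact: dominating_rate_le.
    apply: (dom_var_lipschitz (@dominating_rate_le T) (M := 1)) => s t _ st _.
    by rewrite mul1r ger0_norm// subr_ge0.
  by apply: dom_var_ip; exact: dom_var_velocity.
have [B B0 hB] := dom_var_bounded (@dominating_rate_le T) hx.
apply: (dom_var_lipschitz (@dominating_rate_le T) (M := B)) => s t t0s st tT.
rewrite /kinetic Rintegral_itvB ?bnd_simp//.
have sub : [set` `]s, t]] `<=` [set` `[t0, t]].
  by move=> r /=; rewrite !in_itv /= => /andP[sr ->]; rewrite (le_trans t0s (ltW sr)).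
have ii : mu.-integrable `]s, t] (EFin \o (fun s => s * `|xd s| ^+ 2)).
  exact: integrableS (speed_int t).
apply: le_trans (le_normr_Rintegral _ ii) _ => //.
apply: le_trans (_ : \int[mu]_(r in `]s, t]) B <= _).
  apply: le_Rintegral => //.
  - exact: (integrable_abse ii).
  - rewrite (_ : (fun=> B) = (fun=> B * 1)); last by apply/funext => r; rewrite mulr1.
    apply: integrableZl_EFin => //.
    by apply: integrableS (integrable_cst1 s t) => //; exact: subset_itv_oc_cc.
  - move=> r; rewrite /= in_itv /= => /andP[sr rt].
    by rewrite -(ipxx ipP); apply: hB; rewrite (le_trans t0s (ltW sr)) (le_trans rt tT).
rewrite Rintegral_cst//= lebesgue_measure_itv /= lte_fin.
by case: ltgtP st => //= -> _; rewrite subrr.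
Qed.

(* The last term is a nonnegative primitive of [- (1+q) beta |z|^2 / 2 * t^(q-p)]. *)
Definition lyapunov (z : H) (i : 'I_m) (t : R) : R :=
  t `^ (1 + q) * (energy i t - f i z) + alpha / 2 * kinetic t
  + (1 + q) * (t `^ q * ip (xd t) (x t - z) + alpha / 2 * ip (x t - z) (x t - z)
               + - q / 2 * (t `^ (q - 1) * ip (x t - z) (x t - z)))
  + (1 + q) * beta * `|z| ^+ 2 / 2 / (p - q - 1) * t `^ (q - p + 1).

Lemma dom_var_lyapunov T z i : dv T (lyapunov z i).
Proof.
have Kle := @dominating_rate_le T.
have hw e : dv T (fun t => t `^ e) by exact: dom_var_powR.
have hd : dv T (fun t => x t - z).
  by apply: dom_varD; [exact: dom_var_position|exact: dom_var_cst].
have hdd := dom_var_ip hd hd.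
apply: dom_varD; last exact: dom_var_scale.
apply: dom_varD; [apply: dom_varD|].
- apply: dom_varM => //.
  by apply: dom_varD; [exact: dom_var_energy|exact: dom_var_cst].
- by apply: dom_var_scale; exact: dom_var_kinetic.
- apply: dom_var_scale.
  apply: dom_varD; [apply: dom_varD|].
  + by apply: dom_varM => //; apply: dom_var_ip => //; exact: dom_var_velocity.
  + exact: dom_var_scale.
  + by apply: dom_var_scale; exact: dom_varM.
Qed.

Hypotheses (q_gt0 : 0 < q) (qp : q + 1 < p).

Lemma lyapunov_derive z i t : t0 < t ->
  3 * (1 + q) * t `^ q <= alpha * t -> q * (1 - q) <= beta * t `^ (- p) * t ^+ 2 ->
  is_derive t 1 xd (xdd t) ->
  ip (g i (x t)) (xd t) + beta * t `^ (- p) * ip (x t) (xd t)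
    + ip (xdd t) (xd t) <= - (alpha * t `^ (- q)) * `|xd t| ^+ 2 ->
  ip (xdd t) (x t - z) + alpha * t `^ (- q) * ip (xd t) (x t - z) + (f i (x t) - f i z)
    + beta / 2 * t `^ (- p) * (`|x t| ^+ 2 + `|x t - z| ^+ 2 - `|z| ^+ 2) <= 0 ->
  exists2 d, d <= 0 & is_derive t 1 (lyapunov z i) d.
Proof.
move=> t0t h1 h2 hA hb hc; have t_gt0 := lt_trans t0_gt0 t0t; have hx := x_deriv t0t.
have [de hde De] := energy_derive t0t hA hb.
have Dw e := is_derive1_powR e t_gt0.
have Dd : is_derive t 1 (fun s => x s - z) (xd t).
  by have := is_deriveB hx (is_derive_cst z t 1); rewrite subr0.
have DE : is_derive t 1 (fun s => energy i s - f i z) de.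
  by have := is_deriveB De (is_derive_cst (f i z) t 1); rewrite subr0.
have Ddd := is_derive_ip ipP Dd Dd; have Dud := is_derive_ip ipP hA Dd.
have := is_derive_addf (is_derive_addf (is_derive_addf (is_derive_mulf (Dw (1 + q)) DE)
    (is_derive_mulcf (alpha / 2) (kinetic_derive t0t)))
  (is_derive_mulcf (1 + q) (is_derive_addf (is_derive_addf
     (is_derive_mulf (Dw q) Dud) (is_derive_mulcf (alpha / 2) Ddd))
     (is_derive_mulcf (- q / 2) (is_derive_mulf (Dw (q - 1)) Ddd)))))
  (is_derive_mulcf ((1 + q) * beta * `|z| ^+ 2 / 2 / (p - q - 1)) (Dw (q - p + 1))).
set d := (X in is_derive _ _ _ X) => hd; exists d => //.
have X0 : 0 < t `^ q by exact: powR_gt0.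
have P0 : 0 < t `^ (- p) by exact: powR_gt0.
have tn : t != 0 by rewrite gt_eqF.
(* All powers are reduced to [t ^ q], [t ^ (- p)] and integer powers of [t], so that [field] can
   identify [d] with the left side of [lyapunov_rate_le]. *)
have pwD a b : t `^ (a + b) = t `^ a * t `^ b by rewrite powRD// tn implybT.
have w1 : t `^ (1 + q) = t * t `^ q by rewrite pwD powRr1// ltW.
have w2 : t `^ (1 + q - 1) = t `^ q by congr (_ `^ _); ring.
have w3 : t `^ (q - 1) = t `^ q / t by rewrite pwD powR_inv1// ltW.
have w4 : t `^ (q - 1 - 1) = t `^ q / t ^+ 2.
  by rewrite pwD w3 powR_inv1 ?ltW// expr2 invfM mulrA.
have w5 : t `^ (q - p + 1 - 1) = t `^ q * t `^ (- p) by rewrite addrK pwD.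
have Xi : t `^ (- q) = (t `^ q)^-1 by rewrite powRN.
have := @lyapunov_rate_le R t (t `^ q) (t `^ (- p)) de (f i (x t) - f i z)
  (`|xd t| ^+ 2) (ip (xd t) (x t - z)) (ip (xdd t) (x t - z)) (`|x t - z| ^+ 2)
  (`|x t| ^+ 2) (`|z| ^+ 2) q alpha beta t_gt0 X0 P0 q_gt0 (sqr_ge0 _) (sqr_ge0 _).
move=> /(_ _ _ h1 h2) rate.
apply: le_trans (rate _ _).
- rewrite le_eqVlt; apply/orP; left; apply/eqP.
  rewrite /d w1 w2 w4 w5 w3 /energy (ipC ipP (x t - z) (xd t)) !(ipxx ipP).
  have pq : p - q - 1 != 0 by rewrite gt_eqF// -addrA -opprD subr_gt0.
  by field; rewrite tn pq.
- rewrite -(ler_pM2l X0) Xi in hde; apply: le_trans hde _.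
  rewrite le_eqVlt; apply/orP; left; apply/eqP; field.
  by rewrite gt_eqF.
- rewrite -(pmulr_rle0 _ X0) Xi in hc; apply: le_trans hc.
  rewrite le_eqVlt; apply/orP; left; apply/eqP; field.
  by rewrite gt_eqF.
Qed.

(** Two members of the family differ only by [t ^ (1 + q)] times the difference of the gaps. An
    index active for [lyapunov] thus has the smallest gap, which is the common lower bound [h]
    required in [ae_trajectory]. *)
Let f_shift_le z i j t : t0 < t -> lyapunov z i t <= lyapunov z j t ->
  f i (x t) - f i z <= f j (x t) - f j z.
Proof.
move=> t0t; rewrite /lyapunov 3!lerD2r ler_pM2l ?powR_gt0 ?(lt_trans t0_gt0)//.
rewrite /energy; lra.
Qed.

Lemma lyapunov_le z (i0 : 'I_m) t1 T : t0 <= t1 -> t1 <= T ->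
  (forall t, t1 <= t -> 3 * (1 + q) * t `^ q <= alpha * t) ->
  (forall t, t1 <= t -> q * (1 - q) <= beta * t `^ (- p) * t ^+ 2) ->
  exists i, forall j, lyapunov z i T <= lyapunov z j t1.
Proof.
move=> t01 t1T h1 h2.
apply: (@min_nonincreasing_le R m i0 (lyapunov z) t1 T (dominating_rate T)) => //.
- by apply: integrable_dominating_rate; exact: le_trans t1T.
- exact: dominating_rate_ge0.
- by move=> i; apply: dom_varS t01 _; exact: dom_var_lyapunov.
- apply: negligibleS ae_trajectory => t; apply: contra_not => /= ht /andP[t1t _] i imin.
  have t0t := le_lt_trans t01 t1t; have [hA hb hc] := ht t0t.
  apply: lyapunov_derive => //; [exact/h1/ltW|exact/h2/ltW|].
  by apply: hc => j; exact: f_shift_le.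
Qed.

Lemma kinetic_le_lyapunov z i T : t0 <= T -> 3 * (1 + q) * T `^ q <= alpha * T ->
  (forall j, f j z <= f j (x T)) -> alpha / 2 * kinetic T <= lyapunov z i T.
Proof.
move=> t0T h1 fz; have T0 := lt_le_trans t0_gt0 t0T.
have tn : T != 0 by rewrite gt_eqF.
have w1 : T `^ (1 + q) = T * T `^ q by rewrite powRD ?tn ?implybT// powRr1// ltW.
have w3 : T `^ (q - 1) = T `^ q / T by rewrite powRD ?tn ?implybT// powR_inv1// ltW.
have X0 : 0 < T `^ q by exact: powR_gt0.
have Y0 : 0 < T `^ q / T by exact: divr_gt0.
have {}h1 : 3 * (1 + q) * (T `^ q / T) <= alpha by rewrite mulrA ler_pdivrMr.
have XY : T `^ q = T * (T `^ q / T) by rewrite mulrC divfK.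
have pq : 0 < p - q - 1 by rewrite -addrA -opprD subr_gt0.
have c0 : 0 <= (1 + q) * beta * `|z| ^+ 2 / 2 / (p - q - 1) * T `^ (q - p + 1).
  have q1 : 0 < 1 + q by rewrite addr_gt0.
  by rewrite !mulr_ge0 ?powR_ge0 ?sqr_ge0 ?invr_ge0// ltW.
have E0 : 2^-1 * `|xd T| ^+ 2 <= energy i T - f i z.
  have : 0 <= beta / 2 * (T `^ (- p) * `|x T| ^+ 2).
    by rewrite !mulr_ge0 ?powR_ge0 ?sqr_ge0 ?invr_ge0// ltW.
  rewrite /energy !(ipxx ipP); move: (fz i); lra.
have {}E0 : T * T `^ q * (2^-1 * `|xd T| ^+ 2) <= T * T `^ q * (energy i T - f i z).
  by rewrite ler_pM2l// mulr_gt0.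
have /ler_normlP[ud _] := ip_le_norm ipP (xd T) (x T - z).
have {}ud : (1 + q) * (T `^ q * - ip (xd T) (x T - z)) <=
    (1 + q) * (T `^ q * (`|xd T| * `|x T - z|)).
  by apply: ler_wpM2l; [rewrite addr_ge0// ltW|apply: ler_wpM2l; first exact: ltW].
rewrite /lyapunov w1 w3 !(ipxx ipP).
move: c0 E0 ud h1 XY Y0; set c := _ * T `^ (q - p + 1).
set e := energy i T - _; set Y := T `^ q / T; set X := T `^ q.
set n := `|xd T|; set D := `|x T - z|; set w := ip _ _ => c0 E0 ud h1 XY Y0.
(* Half of this square contains the cross term between velocity and [x T - z]. Its cost
   [(1 + q) ^ 2 * Y * D ^ 2 / 2] and the negative [q / 2] term are paid by [dd], with half of [qY]
   left over. *)
have sq : 0 <= Y * (T * n - (1 + q) * D) ^+ 2 by rewrite mulr_ge0 ?sqr_ge0// ltW.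
have dd : 3 * (1 + q) * Y * ((1 + q) * D ^+ 2) <= alpha * ((1 + q) * D ^+ 2).
  by apply: ler_wpM2r => //; rewrite mulr_ge0 ?sqr_ge0// addr_ge0// ltW.
have qY : 0 <= (1 + q) * Y * D ^+ 2 * (2 + q).
  have q1 : 0 < 1 + q by rewrite addr_gt0.
  have q2 : 0 < 2 + q by rewrite addr_gt0.
  by apply: mulr_ge0; [rewrite mulr_ge0 ?sqr_ge0// mulr_ge0// ltW|exact: ltW].
rewrite XY in E0 ud *; lra.
Qed.

(** * Bounds uniform in the comparison point *)

(** The comparison point will depend on the final time, so the initial value needs a bound in terms
    of [B] alone. The gradient inequality at 0 bounds [f i z] from below, and the nonpositive
    [- q / 2] term is dropped. *)
Lemma lyapunov_bounded i t1 B : t0 <= t1 ->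
  exists C, forall z, `|z| <= B -> lyapunov z i t1 <= C.
Proof.
move=> t01; have t1_gt0 := lt_le_trans t0_gt0 t01.
set G := `|g i 0| * B; set D := `|x t1| + B.
exists (t1 `^ (1 + q) * (energy i t1 - f i 0 + G) + alpha / 2 * kinetic t1
  + (1 + q) * (t1 `^ q * (`|xd t1| * D) + alpha / 2 * D ^+ 2)
  + (1 + q) * beta * B ^+ 2 / 2 / (p - q - 1) * t1 `^ (q - p + 1)) => z zB.
have B0 : 0 <= B by apply: le_trans zB.
have dD : `|x t1 - z| <= D by apply: le_trans (ler_normB _ _) _; rewrite lerD2l.
have D0 : 0 <= D by apply: le_trans dD.
have pq : 0 < p - q - 1 by rewrite -addrA -opprD subr_gt0.
have q1 : 0 < 1 + q by rewrite addr_gt0.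
apply: lerD; [apply: lerD; [rewrite lerD2r|]|].
- apply: ler_wpM2l; first exact: powR_ge0.
  have := gradient_le (f_convex i) (f_grad i) 0 z; rewrite subr0.
  have := ler_norm (- ip (g i 0) z); rewrite normrN.
  have := ip_le_norm ipP (g i 0) z.
  have : `|g i 0| * `|z| <= G by exact: ler_wpM2l.
  lra.
- apply: ler_wpM2l; first exact: ltW.
  rewrite -[leRHS]addr0; apply: lerD; [apply: lerD|].
  + apply: ler_wpM2l; first exact: powR_ge0.
    apply: le_trans (ler_norm _) _; apply: le_trans (ip_le_norm ipP _ _) _.
    exact: ler_wpM2l.
  + apply: ler_wpM2l; first by rewrite divr_ge0// ltW.
    by rewrite (ipxx ipP) lerXn2r ?nnegrE.
  + rewrite !mulNr oppr_le0 (ipxx ipP) !mulr_ge0 ?powR_ge0 ?sqr_ge0//.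
    exact: ltW.
- apply: ler_wpM2r; first exact: powR_ge0.
  apply: ler_wpM2r; first by rewrite invr_ge0 ltW.
  apply: ler_wpM2r => //; apply: ler_wpM2l; first by rewrite mulr_ge0// ltW.
  by rewrite lerXn2r ?nnegrE.
Qed.

Lemma dominating_point : assumption_A3 f t0 beta p x0 v0 ->
  exists B, forall T, t0 <= T ->
    exists2 z, `|z| <= B & forall i, f i z <= f i (x T).
Proof.
have [_ [_ [_ [_ [_ [_ [xt0 xdt0]]]]]]] := sol.
(* The infimum of norms in (A3) need not be attained; the extra 1 admits a point close to it. *)
move=> [ne [B hB]]; exists (B + 1) => T t0T.
set b := fun i => _ in ne hB.
have lev : level_set f b (x T).
  move=> i; have := energy_le i t0T; rewrite /energy xt0 xdt0 !(ipxx ipP).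
  have : 0 <= beta / 2 * (T `^ (- p) * `|x T| ^+ 2) + 2^-1 * `|xd T| ^+ 2.
    by rewrite addr_ge0// !mulr_ge0 ?powR_ge0 ?sqr_ge0 ?invr_ge0// ltW.
  have -> : b i = f i x0 + (beta / 2 * (t0 `^ (- p) * `|x0| ^+ 2) + 2^-1 * `|v0| ^+ 2).
    rewrite /b powRN; congr (_ + (_ + _)); field.
    by rewrite gt_eqF// powR_gt0.
  lra.
have [y [yT py]] := ne _ lev.
have {}hB : inf [set `|z| | z in [set z | forall i, f i z = f i y]] <= B.
  by apply: hB; split=> // i; apply: le_trans (yT i) (lev i).
have infP : has_inf [set `|z| | z in [set z | forall i, f i z = f i y]].
  by split; [exists `|y|, y|exists 0 => _ [z _ <-]].
have [_ [z zy <-] hz] := inf_adherent (ltr01 : 0 < 1 :> R) infP.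
exists z; first by apply: ltW; apply: lt_le_trans hz _; rewrite lerD2r.
by move=> i; rewrite zy; exact: yT.
Qed.

(** Both inequalities compare a constant with a positive power of [t], of exponent [1 - q] and
    [2 - p] respectively. *)
Lemma large_time : q < 1 -> p < 2 -> exists2 t1, t0 <= t1 & forall t, t1 <= t ->
  3 * (1 + q) * t `^ q <= alpha * t /\ q * (1 - q) <= beta * t `^ (- p) * t ^+ 2.
Proof.
move=> q1 p2.
have key c e : 0 < e -> exists2 s, t0 <= s & forall t, s <= t -> c <= t `^ e.
  move=> e0; exists (t0 + `|c| `^ e^-1) => [|t]; first by rewrite lerDl powR_ge0.
  move=> ht; have tc : `|c| `^ e^-1 <= t by apply: le_trans ht; rewrite lerDr ltW.
  apply: le_trans (ler_norm c) _.
  have -> : `|c| = (`|c| `^ e^-1) `^ e by rewrite -powRrM mulVf ?gt_eqF// powRr1.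
  have tge0 : 0 <= t by apply: le_trans tc; exact: powR_ge0.
  by apply: ge0_ler_powR; rewrite ?nnegrE ?powR_ge0// ltW.
have [s s0 hs] := key (3 * (1 + q) / alpha) (1 - q) (etrans (subr_gt0 _ _) q1).
have [r r0 hr] := key (q * (1 - q) / beta) (2 - p) (etrans (subr_gt0 _ _) p2).
exists (Num.max s r) => [|t]; first by rewrite le_max s0.
rewrite ge_max => /andP[st rt]; have t_gt0 : 0 < t by rewrite (lt_le_trans t0_gt0)// (le_trans s0).
have tn : t != 0 by rewrite gt_eqF.
split.
- have := hs t st; rewrite ler_pdivrMr// => h.
  apply: le_trans (_ : t `^ (1 - q) * alpha * t `^ q <= _).
    by apply: ler_wpM2r => //; exact: powR_ge0.
  rewrite mulrAC -powRD; last by rewrite tn implybT.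
  by rewrite subrK (powRr1 (ltW t_gt0)) mulrC.
- have := hr t rt; rewrite ler_pdivrMr// => /le_trans; apply.
  rewrite mulrC -mulrA; apply: ler_wpM2l; first exact: ltW.
  by rewrite -(powR_mulrn 2 (ltW t_gt0)) -powRD ?tn ?implybT// addrC.
Qed.

(** * Passage to the half-line *)

(** Monotone convergence along the intervals [[t0, t0 + n]]. *)
Lemma kinetic_integral_le B : (forall T, t0 <= T -> kinetic T <= B) ->
  (\int[mu]_(s in `[t0, +oo[) (s * `|xd s| ^+ 2)%:E <= B%:E)%E.
Proof.
move=> hB; rewrite itv_bndy_bigcup_BRight.
have spd0 n s : `[t0, t0 + n%:R]%classic s -> (0 <= (s * `|xd s| ^+ 2)%:E)%E.
  rewrite /= in_itv /= => /andP[t0s _]; rewrite lee_fin mulr_ge0 ?sqr_ge0//.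
  by rewrite (le_trans _ t0s)// ltW.
have mspd n : measurable_fun `[t0, t0 + n%:R] (EFin \o (fun s => s * `|xd s| ^+ 2)).
  exact: measurable_int (speed_int _).
have nd : nondecreasing_seq (fun n : nat => `[t0, t0 + n%:R]%classic).
  move=> k n kn; apply/subsetPset => r /=; rewrite !in_itv /= => /andP[-> /le_trans]; apply.
  by rewrite lerD2l ler_nat.
have cv := @ge0_nondecreasing_set_cvg_integral _ _ _ _ _ (@lebesgue_measure R) nd
  (fun n => measurable_itv _) mspd spd0.
apply: (cvge_to_le cv).
apply: nearW => n.
rewrite -[leLHS]fineK; last exact: integrable_fin_num.
by rewrite lee_fin; apply: hB; rewrite lerDl.
Qed.

Lemma kinetic_nondecreasing s t : t0 <= s -> s <= t -> kinetic s <= kinetic t.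
Proof.
move=> t0s st; rewrite -subr_ge0 /kinetic Rintegral_itvB ?bnd_simp//.
apply: Rintegral_ge0 => r /=; rewrite in_itv /= => /andP[sr _].
by rewrite mulr_ge0 ?sqr_ge0// ltW// (lt_trans t0_gt0)// (le_lt_trans t0s).
Qed.

(** The point [z] changes with [T], but [t1], [B] and [C] do not, hence the bound is uniform. Times
    before [t1] follow by monotonicity of [kinetic]. *)
Lemma kinetic_bounded (i0 : 'I_m) : q < 1 -> p < 2 ->
  assumption_A3 f t0 beta p x0 v0 ->
  exists C, forall T, t0 <= T -> kinetic T <= C.
Proof.
move=> q1 p2 /dominating_point[B hB]; have [t1 t01 ht1] := large_time q1 p2.
have [C hC] := lyapunov_bounded i0 B t01.
have hT T : t1 <= T -> kinetic T <= C / (alpha / 2).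
  move=> t1T; have t0T := le_trans t01 t1T.
  have [z zB fz] := hB T t0T.
  have [i /(_ i0) hi] := lyapunov_le z i0 t01 t1T
    (fun t h => (ht1 t h).1) (fun t h => (ht1 t h).2).
  rewrite ler_pdivlMr ?divr_gt0// mulrC.
  apply: le_trans (kinetic_le_lyapunov i t0T (ht1 T t1T).1 fz) _.
  exact: le_trans hi (hC z zB).
exists (C / (alpha / 2)) => T t0T; have [|Tt1] := leP t1 T; first exact: hT.
by apply: le_trans (hT t1 (lexx _)); apply: kinetic_nondecreasing => //; exact: ltW.
Qed.

Lemma weighted_kinetic_integral_lty C e : e <= 1 ->
  (forall T, t0 <= T -> kinetic T <= C) ->
  (\int[mu]_(s in `[t0, +oo[) (s `^ e * `|xd s| ^+ 2)%:E < +oo)%E.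
Proof.
move=> e1 hC.
have mxd : measurable_fun `[t0, +oo[ (fun s => `|xd s| ^+ 2).
  apply: subspace_continuous_measurable_fun => // s.
  by apply: cvgM; apply: cvg_norm; exact: xd_cont.
have mpow (a : R) : measurable_fun `[t0, +oo[ (fun s : R => s `^ a).
  by apply: measurable_funTS; exact: measurable_powR.
have msp : measurable_fun `[t0, +oo[ (fun s => s * `|xd s| ^+ 2).
  by apply: measurable_funM => //; exact: measurable_id.
have s_gt0 s : t0 <= s -> 0 < s by exact: lt_le_trans.
(* For [s >= t0] and [e <= 1], the weight [s ^ e] is at most [t0 ^ (e - 1) * s]. *)
apply: (@le_lt_trans _ _ (\int[mu]_(s in `[t0, +oo[)
    ((t0 `^ (e - 1))%:E * (s * `|xd s| ^+ 2)%:E))%E).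
  apply: ge0_le_integral => //.
  - by move=> s _; rewrite lee_fin mulr_ge0 ?powR_ge0 ?sqr_ge0.
  - by apply/measurable_EFinP; apply: measurable_funM => //; exact: mpow.
  - by apply: measurable_funeM; exact/measurable_EFinP.
  - move=> s; rewrite /= in_itv /= andbT => t0s; have s0 := s_gt0 _ t0s.
    rewrite -EFinM lee_fin [leRHS]mulrA; apply: ler_wpM2r; first exact: sqr_ge0.
    have -> : s `^ e = s `^ (e - 1) * s.
      by rewrite -[in LHS](subrK 1 e) powRD ?(powRr1 (ltW s0))// (gt_eqF s0) implybT.
    apply: ler_wpM2r; first exact: ltW.
    rewrite -(opprK (e - 1)) !(powRN _ (- (e - 1))) lef_pV2 ?posrE ?powR_gt0//.
    by apply: ge0_ler_powR; rewrite ?nnegrE //; [lra|exact: ltW|exact: ltW].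
rewrite ge0_integralZl//.
- rewrite (le_lt_trans (lee_wpmul2l _ (kinetic_integral_le hC)))//.
    by rewrite lee_fin powR_ge0.
  by rewrite -EFinM ltry.
- exact/measurable_EFinP.
- move=> s; rewrite /= in_itv /= andbT => /s_gt0 s0.
  by rewrite lee_fin mulr_ge0 ?sqr_ge0// ltW.
- by rewrite lee_fin powR_ge0.
Qed.

End trajectory.

Theorem mainTheorem16 (R : realType) (H : completeNormedModType R)
  (ip : H -> H -> R) (m : nat) (f : 'I_m -> H -> R) (g : 'I_m -> H -> H)
  (t0 alpha beta q p : R) (x0 v0 : H) (x xd xdd : R -> H) (r : R) :
  is_inner_product ip ->
  (0 < m)%N ->
  (forall i, convex_fun (f i)) ->
  (forall i, is_gradient ip (f i) (g i)) ->
  (forall i, lipschitz_fun (g i)) ->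
  0 < t0 -> 0 < alpha -> 0 < beta ->
  0 < q <= 1 -> 0 < p < 2 -> q + 1 < p ->
  assumption_A3 f t0 beta p x0 v0 ->
  assumption_A4 f ->
  MTRIGS_solution ip g t0 alpha beta q p x0 v0 x xd xdd ->
  q <= r <= (q + 1) / 2 ->
  (\int[@lebesgue_measure R]_(s in `[t0, +oo[)
      (s `^ (2 * r - q) * `|xd s| ^+ 2)%:E < +oo)%E.
Proof.
move=> ipP m0 f_convex f_grad g_lip t0_gt0 alpha_gt0 beta_gt0 /andP[q_gt0 _].
move=> /andP[p_gt0 p2] qp A3 _ sol /andP[_ rq].
(* From [q + 1 < p < 2]. The closing [lra] obtains [2 * r - q <= 1] from the upper bound on [r]. *)
have q1 : q < 1 by lra.
have [C hC] := kinetic_bounded ipP f_convex f_grad g_lip t0_gt0 alpha_gt0 beta_gt0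
  sol p_gt0 q_gt0 qp (Ordinal m0) q1 p2 A3.
by apply: (weighted_kinetic_integral_lty t0_gt0 sol _ hC); lra.
Qed.
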